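(* Let $n, a, b$ be positive integers with $\gcd(a,b)=1$. If $\gcd(n!,b)=1$, then there exist positive integers $a_1,\dots,a_n$ such that $$\frac{(a+b)(a+2b)\cdots(a+nb)}{1\cdot 2\cdots n}=\prod_{i=1}^{n}a_i,$$ where $a_i \mid (a+bi)$ for every $1\le i\le n$, and $\gcd(a_i,a_j)=1$ for all $1\le i\ne j\le n$. *)

(* Defs.v *)
From mathcomp Require Export all_boot all_order all_algebra.

Set Implicit Arguments.
Unset Strict Implicit.
Unset Printing Implicit Defensive.

(* Main.v *)
Require Import Defs.
From mathcomp Require Import all_boot all_order all_algebra.
From mathcomp Require Import zify.

Set Implicit Arguments.
Unset Strict Implicit.
Unset Printing Implicit Defensive.

(** Write [x i = a + i * b] and let [P] be the product of [x 1], ..., [x n].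
    Since [b] is invertible modulo [n`!], [P] is, up to a unit modulo [n`!],
    a product of [n] consecutive integers; hence [n`!] divides [P]
    ([dvdn_fact_prod_arith]) and [Q = P %/ n`!] is the number to be factored.

    For each prime [p] choose an index [k p] at which the [p]-adic valuation
    of [x] is largest, and give the whole [p]-part of [Q] to that index: [c i]
    is the part of [Q] supported by the primes [p] with [k p = i].  The [c i]
    are then pairwise coprime and their product is [Q].

    What remains is [c i %| x i], that is, [logn p Q <= logn p (x (k p))]: all
    the other terms together must not contain more factors [p] than [n`!].  If
    [i] differs from [k = k p], the power of [p] in [x i] also divides [x k],
    hence divides [x i - x k = (i - k) * b]; it is prime to [b], so it divides
    [i - k].  The product of the [`|i - k|] over [i != k] is
    [(k - 1)! * (n - k)!], a divisor of [n`!] ([dvdn_prod_dist_fact],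
    [dvdn_part_others_fact]). *)

Lemma eqn_mod_prod (I : Type) (r : seq I) (F G : I -> nat) d :
  (forall i, F i = G i %[mod d]) ->
  \prod_(i <- r) F i = \prod_(i <- r) G i %[mod d].
Proof.
move=> FG; elim/big_ind2: _ => // x1 x2 y1 y2 e1 e2.
by rewrite -modnMm e1 e2 modnMm.
Qed.

(** The product is the binomial coefficient ['C(m + n, n)] times [n`!]. *)
Lemma dvdn_fact_prod_consecutive n m : n`! %| \prod_(1 <= i < n.+1) (m + i).
Proof.
suff -> : \prod_(1 <= i < n.+1) (m + i) = 'C(m + n, n) * n`!.
  exact: dvdn_mull.
rewrite bin_ffact; elim: n => [|n IHn]; first by rewrite big_geq.
by rewrite big_nat_recr //= IHn addnS ffactSS mulnC.
Qed.

(** If [u] inverts [b] modulo [n`!], then [u * (a + i * b)] is congruent to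
    [u * a + i], and the factors [u] can be cancelled. *)
Lemma dvdn_fact_prod_arith n a b : 0 < b -> coprime n`! b ->
  n`! %| \prod_(1 <= i < n.+1) (a + i * b).
Proof.
move=> b_gt0 co_nb; case: (egcdnP n`! b_gt0) => u v.
rewrite gcdnC (eqP co_nb) => Euv _.
have co_nu : coprime n`! (u ^ n).
  apply: coprimeXr; suff : coprime n`! (u * b) by rewrite coprimeMr => /andP[].
  by rewrite Euv /coprime gcdnMDl gcdn1.
rewrite -(Gauss_dvdr _ co_nu).
have -> : u ^ n * \prod_(1 <= i < n.+1) (a + i * b)
          = \prod_(1 <= i < n.+1) (u * (a + i * b)).
  by rewrite big_split /= prod_nat_const_nat subn1.
have Emod i :
    u * (a + i * b) = u * a + i %[mod n`!].
  rewrite mulnDr mulnCA Euv mulnDr muln1 mulnA.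
  by rewrite addnCA modnMDl.
rewrite /dvdn (eqn_mod_prod _ Emod).
exact: dvdn_fact_prod_consecutive.
Qed.

(** The two halves of the product are [(k - 1)!] and [(n - k)!], and
    [(k - 1)! * (n - k)!] divides [(n - 1)!]; in truncated subtraction
    [(i - k) + (k - i)] is the distance between [i] and [k]. *)
Lemma dvdn_prod_dist_fact n k : 1 <= k <= n ->
  \prod_(1 <= i < n.+1 | i != k) ((i - k) + (k - i)) %| n`!.
Proof.
case: k => // k /= lt_kn.
suff -> : \prod_(1 <= i < n.+1 | i != k.+1) ((i - k.+1) + (k.+1 - i))
          = k`! * (n - k.+1)`!.
  case: n lt_kn => // n le_kn.
  rewrite subSS factS -(bin_fact (le_kn : k <= n)) mulnA; exact: dvdn_mull.
rewrite (@big_cat_nat _ _ _ k.+1) //=; last exact: leqW.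
rewrite [X in _ * X]big_ltn_cond ?ltnS // eqxx /=; congr (_ * _).
  rewrite fact_prod big_nat_rev big_nat_cond [RHS]big_nat_cond.
  apply: eq_big => i; first by case: (boolP (_ <= _ < _)) => //=; lia.
  lia.
have -> : n.+1 = (n - k.+1).+1 + k.+1 by lia.
rewrite -[k.+2]add1n big_addn addnK fact_prod big_nat_cond [RHS]big_nat_cond.
apply: eq_big => i; first by case: (boolP (_ <= _ < _)) => //=; lia.
lia.
Qed.

Lemma partn_prod (I : Type) (r : seq I) (P : pred I) (F : I -> nat) pi :
  (forall i, P i -> 0 < F i) ->
  (\prod_(i <- r | P i) F i)`_pi = \prod_(i <- r | P i) (F i)`_pi.
Proof.
move=> F_gt0.
(* Positivity of the partial products, needed for [partnM], is carried along. *)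
pose K m n := (0 < m) && (m`_pi == n).
suff /andP[_ /eqP] : K (\prod_(i <- r | P i) F i)
                       (\prod_(i <- r | P i) (F i)`_pi) by [].
elim/big_ind2: _ => [|m1 n1 m2 n2|i /F_gt0 Fi]; rewrite /K ?Fi ?partn1 //=.
move=> /andP[m1_gt0 /eqP <-] /andP[m2_gt0 /eqP <-].
by rewrite muln_gt0 m1_gt0 m2_gt0 partnM /=.
Qed.

Lemma dvdn_partn_mono p m n : logn p m <= logn p n -> m`_p %| n`_p.
Proof. by move=> le_mn; rewrite !p_part dvdn_exp2l. Qed.

(** For [i != k] the [p]-part of [a + i * b] divides the distance between [i]
    and [k]: by maximality it divides [a + k * b] too, hence the difference
    of the two terms, and it is prime to [b] since [a + i * b] is. *)
Lemma dvdn_part_others_fact n a b p k : 0 < a -> coprime a b -> 1 <= k <= n ->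
    (forall i, 1 <= i <= n -> logn p (a + i * b) <= logn p (a + k * b)) ->
  (\prod_(1 <= i < n.+1 | i != k) (a + i * b))`_p %| n`!.
Proof.
move=> a_gt0 co_ab k_in k_max.
have x_gt0 i : 0 < a + i * b by rewrite addn_gt0 a_gt0.
rewrite partn_prod //; apply: dvdn_trans (dvdn_prod_dist_fact k_in).
rewrite big_nat_cond [X in _ %| X]big_nat_cond.
apply: (big_ind2 (fun m n => m %| n)) => // [*|i /andP[i_in _]].
  exact: dvdn_mul.
have dvd_xi : (a + i * b)`_p %| a + i * b := dvdn_part _ _.
have dvd_xk : (a + i * b)`_p %| a + k * b.
  by apply: (dvdn_trans _ (dvdn_part p _)); apply/dvdn_partn_mono/k_max.
have co_xib : coprime (a + i * b)`_p b.
  by apply: coprime_dvdl dvd_xi _; rewrite /coprime addnC gcdnC gcdnMDl gcdnC.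
rewrite -(Gauss_dvdl _ co_xib) mulnDl !mulnBl.
by rewrite -(subnDl a (i * b)) -(subnDl a (k * b)) dvdn_add // dvdn_sub.
Qed.

(** The [p]-part of [n`!] absorbs that of the terms other than [a + k * b], so
    what survives in the quotient is bounded by the [p]-part of [a + k * b]. *)
Lemma dvdn_part_quotient n a b p k : 0 < a -> 0 < b -> coprime a b ->
    coprime n`! b -> 1 <= k <= n ->
    (forall i, 1 <= i <= n -> logn p (a + i * b) <= logn p (a + k * b)) ->
  ((\prod_(1 <= i < n.+1) (a + i * b)) %/ n`!)`_p %| a + k * b.
Proof.
move=> a_gt0 b_gt0 co_ab co_nb k_in k_max.
have x_gt0 i : 0 < a + i * b by rewrite addn_gt0 a_gt0.
set P := \prod_(1 <= i < n.+1) _; set Q := P %/ n`!.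
have P_gt0 : 0 < P by rewrite prodn_gt0.
have defP : Q * n`! = P by rewrite divnK ?dvdn_fact_prod_arith.
have Q_gt0 : 0 < Q by move: P_gt0; rewrite -defP muln_gt0 => /andP[].
apply: (dvdn_trans _ (dvdn_part p _)).
rewrite -(@dvdn_pmul2r n`!`_p) ?part_gt0 // -partnM ?fact_gt0 // defP /P.
rewrite (bigD1_seq k) ?iota_uniq ?mem_index_iota //= partnM ?prodn_cond_gt0 //.
apply: dvdn_mul => //; rewrite -(part_pnat_id (part_pnat p _)).
by apply: partn_dvd; rewrite ?fact_gt0 ?dvdn_part_others_fact.
Qed.

(** Each prime power in the factorization of [m] goes to exactly one factor. *)
Lemma prod_partn_fibers m n (k : nat -> nat) :
    0 < m -> (forall p, 1 <= k p <= n) ->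
  \prod_(1 <= i < n.+1) m`_[pred p | k p == i] = m.
Proof.
move=> m_gt0 k_in; rewrite {1}/partn (exchange_big_dep predT) //=.
rewrite -[RHS]partnT // /partn.
apply: eq_bigr => p _.
under eq_bigl => i do rewrite inE eq_sym.
by rewrite big_nat1_eq ltnS k_in.
Qed.

Theorem theorem2 (n a b : nat) (hn : 0 < n) (ha : 0 < a) (hb : 0 < b)
    (hab : gcdn a b = 1) (hnb : gcdn n`! b = 1) :
  exists c : nat -> nat,
    [/\ forall i : nat, 1 <= i <= n -> 0 < c i,
        ((\prod_(1 <= i < n.+1) (a + i * b)%N%:R)
           / (\prod_(1 <= i < n.+1) i%:R)
         = \prod_(1 <= i < n.+1) (c i)%:R :> rat)%R,
        forall i : nat, 1 <= i <= n -> c i %| a + b * i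
      & forall i j : nat, 1 <= i <= n -> 1 <= j <= n -> i <> j ->
          gcdn (c i) (c j) = 1].
Proof.
have co_ab : coprime a b by rewrite /coprime hab.
have co_nb : coprime n`! b by rewrite /coprime hnb.
set P := \prod_(1 <= i < n.+1) (a + i * b); pose Q := P %/ n`!.
have P_gt0 : 0 < P by rewrite prodn_gt0 // => i; rewrite addn_gt0 ha.
have defP : Q * n`! = P by rewrite divnK ?dvdn_fact_prod_arith.
have Q_gt0 : 0 < Q by move: P_gt0; rewrite -defP muln_gt0 => /andP[].
pose k p : nat :=
  [arg max_(i > (ord_max : 'I_n.+1) | 0 < i) logn p (a + i * b)].
have kP p : 1 <= k p <= n /\
    (forall i, 1 <= i <= n -> logn p (a + i * b) <= logn p (a + k p * b)).
  rewrite /k; case: arg_maxnP => //= j j_gt0 j_max.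
  rewrite j_gt0 -ltnS ltn_ord; split=> // i /andP[i_gt0 le_in].
  exact: (j_max (Ordinal (le_in : i < n.+1))).
exists (fun i => Q`_[pred p | k p == i]); split=> [i _||i _|i j _ _ ne_ij].
- exact: part_gt0.
- rewrite -!GRing.natr_prod prod_partn_fibers //; last by move=> p; case: (kP p).
  rewrite -fact_prod -/P -defP GRing.natrM GRing.mulfK //.
  by rewrite Num.Theory.pnatr_eq0 -lt0n fact_gt0.
- rewrite mulnC; apply/dvdn_partP => [|p]; first exact: part_gt0.
  rewrite pi_of_part // => /andP[_ /eqP <-].
  have [k_in k_max] := kP p.
  apply: dvdn_trans (dvdn_part_quotient ha hb co_ab co_nb k_in k_max).
  by apply: partn_dvd => //; apply: dvdn_part.
- apply/eqP/(pnat_coprime (part_pnat _ Q)).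
  apply: sub_in_pnat (part_pnat _ Q) => p _ /eqP kpj.
  by rewrite !inE kpj eq_sym; apply/eqP.
Qed.
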